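(* If $(X,d)$ is any metric space with $|X|>1$, then $C_{(X,d)}\geq \varphi$, where $\varphi=\frac{1+\sqrt{5}}{2}$.
   Context: For a metric space $(X,d)$, write $B(x,r)=\{y\in X: d(x,y)<r\}$ for $x\in X$, $r>0$. All measures $\mu$ on $X$ considered are Borel regular and non-trivial in the sense that $0<\mu(B(x,r))<\infty$ for every $x\in X$ and $r>0$. Such a $\mu$ is called doubling if there is a constant $C\ge 1$ with $\mu(B(x,2r))\le C\mu(B(x,r))$ for all $x\in X$, $r>0$; in that case $C_\mu=\sup_{x\in X,\,r>0}\frac{\mu(B(x,2r))}{\mu(B(x,r))}$. The least doubling constant of $(X,d)$ is $C_{(X,d)}=\inf\{C_\mu:\mu\text{ doubling measure on }(X,d)\}$, with $C_{(X,d)}=\infty$ if no doubling measure exists on $(X,d)$. *)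

(* Defs.v *)
From HB Require Import structures.
From mathcomp Require Import all_boot all_order all_algebra.
From mathcomp Require Import all_classical all_reals all_analysis.

Set Implicit Arguments.
Unset Strict Implicit.
Unset Printing Implicit Defensive.

Import Order.TTheory GRing.Theory Num.Theory.
Import numFieldNormedType.Exports.

Local Open Scope classical_set_scope.
Local Open Scope ring_scope.

(* In a [metricType R], [ball x r] is [[set y | mdist x y < r]] (ballEmdist),
   and the topology is the one induced by [mdist]. *)

Definition borel_set (T : topologicalType) (A : set T) : Prop :=
  <<s [set U : set T | open U] >> A.

(* As usual in analysis on metric spaces, a Borel regular measure is an outer
   measure, defined on all subsets. *)
Definition borel_regular (R : realType) (T : topologicalType)
    (mu : {outer_measure set T -> \bar R}) : Prop :=
  (forall A : set T, borel_set A -> mu.-caratheodory A) /\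
  (forall A : set T, exists B : set T,
      [/\ borel_set B, A `<=` B & mu B = mu A]).

Definition ball_nontrivial (R : realType) (X : metricType R)
    (mu : {outer_measure set X -> \bar R}) : Prop :=
  forall (x : X) (r : R), 0 < r ->
    (0 < mu (ball x r))%E /\ (mu (ball x r) < +oo)%E.

Definition doubling_measure (R : realType) (X : metricType R)
    (mu : {outer_measure set X -> \bar R}) : Prop :=
  [/\ borel_regular mu, ball_nontrivial mu &
      exists2 C : R, 1 <= C & forall (x : X) (r : R), 0 < r ->
        (mu (ball x (2 * r)) <= C%:E * mu (ball x r))%E].

Definition doubling_constant (R : realType) (X : metricType R)
    (mu : {outer_measure set X -> \bar R}) : \bar R :=
  ereal_sup [set c : \bar R | exists (x : X) (r : R),
    0 < r /\ c = (mu (ball x (2 * r)) / mu (ball x r))%E].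

(* The infimum of the empty set is [+oo], which is the value required when
   there is no doubling measure. *)
Definition least_doubling_constant (R : realType) (X : metricType R) : \bar R :=
  ereal_inf [set doubling_constant mu |
             mu in [set mu : {outer_measure set X -> \bar R} |
                    doubling_measure mu]].

Definition golden_ratio (R : realType) : R := (1 + Num.sqrt 5) / 2.

(* Main.v *)
Require Import Defs.
From mathcomp Require Import all_boot all_order all_algebra.
From mathcomp Require Import all_classical all_reals all_analysis.
From mathcomp Require Import lra ring.

(** Let x, y be distinct points, d(x, y) = 3r, where by symmetry
    mu(B(x, 2r)) <= mu(B(y, 2r)).  The balls B(x, 2r) and B(y, r) are disjoint
    and contained in B(x, 4r).  If k bounds all doubling ratios of mu, then
    k mu(B(x, 2r)) >= mu(B(x, 4r)) >= mu(B(x, 2r)) + mu(B(y, r))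
                   >= mu(B(x, 2r)) + mu(B(y, 2r)) / k,
    so k >= 1 + 1/k, that is k >= phi. *)

Import Order.TTheory GRing.Theory Num.Theory.

Local Open Scope classical_set_scope.
Local Open Scope ring_scope.

Lemma golden_ratio_gt0 (R : realType) : 0 < golden_ratio R.
Proof. by rewrite divr_gt0// ltr_wpDr// sqrtr_ge0. Qed.

(** Besides positivity, this is all the main argument uses about [golden_ratio]. *)
Lemma golden_ratio_sqr (R : realType) :
  golden_ratio R * golden_ratio R = golden_ratio R + 1.
Proof.
have s5 : Num.sqrt 5 ^+ 2 = 5 :> R by rewrite sqr_sqrtr.
rewrite /golden_ratio; move: (Num.sqrt 5) s5 => s s5.
have -> : (1 + s) / 2 * ((1 + s) / 2) = (1 + 2 * s + s ^+ 2) / 4 by field.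
by rewrite s5; field.
Qed.

Lemma open_metric_ball (R : realType) (X : metricType R) (x : X) (r : R) :
  open (ball x r).
Proof.
rewrite openE => y; rewrite ballEmdist /= => xyr.
apply/nbhs_ballP; exists (r - mdist x y); first by rewrite /= subr_gt0.
move=> z; rewrite !ballEmdist /= => yz.
by have := metric_triangle x y z; lra.
Qed.

Section ball_measure.
Variables (R : realType) (X : metricType R).
Variable mu : {outer_measure set X -> \bar R}.

Lemma ball_measure_fin_num (x : X) (r : R) : ball_nontrivial mu -> 0 < r ->
  mu (ball x r) \is a fin_num.
Proof. by move=> /(_ x r) /[apply] -[mu0 muoo]; rewrite gt0_fin_numE. Qed.

Lemma fine_ball_measure_gt0 (x : X) (r : R) : ball_nontrivial mu -> 0 < r ->
  0 < fine (mu (ball x r)).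
Proof.
move=> nt r0; rewrite -lte_fin fineK ?ball_measure_fin_num//.
by have [] := nt x r r0.
Qed.

(** Serves the argument by contradiction, with [k] the golden ratio: the assumed strict bound on the
    supremum becomes strict inequalities between reals. *)
Lemma doubling_constant_lt (k : R) (x : X) (r : R) : ball_nontrivial mu ->
  (doubling_constant mu < k%:E)%E -> 0 < r ->
  fine (mu (ball x (2 * r))) < k * fine (mu (ball x r)).
Proof.
move=> nt muk r0; have r20 : 0 < 2 * r by rewrite mulr_gt0.
have m0 := fine_ball_measure_gt0 x _ nt r0.
rewrite -ltr_pdivrMr// -lte_fin; apply: le_lt_trans muk.
apply: ereal_sup_ubound; exists x, r; split => //.
rewrite -[in RHS](fineK (ball_measure_fin_num x _ nt r20)).
rewrite -[in RHS](fineK (ball_measure_fin_num x _ nt r0)).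
(* [inver] treats inversion at zero separately; [m0] excludes that case. *)
by rewrite inver gt_eqF.
Qed.

(** Testing the Carathéodory condition of [A] on [C] splits [C] into [A] and a remainder that
    contains [B]. *)
Lemma outer_measure_disjointU_le (A B C : set X) : mu.-caratheodory A ->
  A `<=` C -> B `<=` C -> A `&` B = set0 -> (mu A + mu B <= mu C)%E.
Proof.
move=> mA subA subB AB; rewrite (mA C) (setIidr subA); apply: leeD => //.
apply: le_outer_measure => z Bz; split; first exact: subB.
by move=> Az; have : (A `&` B) z by []; rewrite AB.
Qed.

(** The triangle inequality gives disjointness from 2r + r = 3r and containment in the large ball
    from 3r + r = 4r. *)
Lemma ball_measure_disjoint_le (x y : X) (r : R) :
  borel_regular mu -> ball_nontrivial mu -> 0 < r -> mdist x y = 3 * r ->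
  fine (mu (ball x (2 * r))) + fine (mu (ball y r)) <=
  fine (mu (ball x (2 * (2 * r)))).
Proof.
move=> [muB _] nt r0 xy.
have r20 : 0 < 2 * r by rewrite mulr_gt0.
have r40 : 0 < 2 * (2 * r) by rewrite mulr_gt0.
rewrite -lee_fin EFinD !fineK ?ball_measure_fin_num//.
apply: outer_measure_disjointU_le.
- by apply: muB; apply: sub_sigma_algebra; exact: open_metric_ball.
- by apply: le_ball; lra.
- move=> z; rewrite !ballEmdist /= => yz.
  by have := metric_triangle x y z; lra.
- apply/seteqP; split => // z; rewrite !ballEmdist /= => -[xz yz].
  by have := metric_triangle x z y; rewrite (metric_sym z y); lra.
Qed.

Lemma golden_ratio_le_doubling_constant (x y : X) :
  borel_regular mu -> ball_nontrivial mu -> x <> y ->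
  ((golden_ratio R)%:E <= doubling_constant mu)%E.
Proof.
move=> reg nt xy; rewrite leNgt; apply/negP => muphi.
pose r := mdist x y / 3.
have r0 : 0 < r by rewrite divr_gt0// mdist_gt0; exact/eqP.
have xyr : mdist x y = 3 * r by rewrite /r; field.
(* [@r] keeps the body of [r], so after exchanging the points [metric_sym] restores the same
   radius. *)
wlog xley : x y {xy} @r r0 xyr /
    fine (mu (ball x (2 * r))) <= fine (mu (ball y (2 * r))).
  move=> H; have [|/ltW] := leP (fine (mu (ball x (2 * r))))
    (fine (mu (ball y (2 * r)))); first exact: H.
  by move: (H y x); rewrite metric_sym; exact.
have r20 : 0 < 2 * r by rewrite mulr_gt0.
have x4 := doubling_constant_lt _ x _ nt muphi r20.
have y2 := doubling_constant_lt _ y _ nt muphi r0.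
have sub := ball_measure_disjoint_le x y r reg nt r0 xyr.
have phi0 := golden_ratio_gt0 R.
have phi2 := golden_ratio_sqr R.
set p := golden_ratio R in x4 y2 phi0 phi2.
(* Write a = mu(B(x, 2r)) and b = mu(B(y, r)). The second factor is positive by [x4] and [sub]. As
   p^2 = p + 1, the product equals a - p b, which is negative by [xley] and [y2]. *)
have : 0 < p * (p * fine (mu (ball x (2 * r))) -
  fine (mu (ball x (2 * r))) - fine (mu (ball y r))).
  by rewrite mulr_gt0//; lra.
rewrite !mulrBr mulrA phi2; lra.
Qed.

End ball_measure.

Theorem proposition2p6 (R : realType) (X : metricType R)
    (hX : exists x y : X, x <> y) :
  ((golden_ratio R)%:E <= least_doubling_constant X)%E.
Proof.
have [x [y xy]] := hX.
apply: le_ereal_inf_tmp => _ [mu [reg nt _] <-].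
exact: (golden_ratio_le_doubling_constant _ _ _ x y).
Qed.
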